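(* For every $\omega\in\mathbb{B}$ with $\mathrm{Re}_{\mathbf{j}}(\omega)\gg1$, $$\zeta(\omega)\,\Gamma(\omega)=\int_0^\infty\frac{t^{\omega-1}}{e^t-1}\,dt.$$
   Context: $\mathbb{D}=\{x+\mathbf{j}y:x,y\in\mathbb{R}\}$, $\mathbf{j}^2=1$, $\mathbf{j}\notin\mathbb{R}$, is the algebra of hyperbolic numbers; with $\mathbf{e}_1=\frac{1+\mathbf{j}}{2}$, $\mathbf{e}_2=\frac{1-\mathbf{j}}{2}$, $z=x+\mathbf{j}y$ equals $\pi_1(z)\mathbf{e}_1+\pi_2(z)\mathbf{e}_2$, where $\pi_1(z)=x+y$, $\pi_2(z)=x-y$. For $z,w\in\mathbb{D}$, $z\ll w$ means $\pi_k(z)<\pi_k(w)$ for $k=1,2$. $\mathbb{B}=\mathbb{D}+\mathbf{i}\mathbb{D}$ is the commutative real algebra of bicomplex numbers $a+b\mathbf{i}+c\mathbf{j}+d\mathbf{k}$ ($a,b,c,d\in\mathbb{R}$), with $\mathbf{i}^2=\mathbf{k}^2=-1$, $\mathbf{j}^2=1$, $\mathbf{i}\mathbf{k}=\mathbf{k}\mathbf{i}=\mathbf{j}$. Each $\omega\in\mathbb{B}$ is uniquely $\omega=\mathrm{Re}_{\mathbf{j}}(\omega)+\mathbf{i}\,\mathrm{Im}_{\mathbf{j}}(\omega)$ with $\mathrm{Re}_{\mathbf{j}}(\omega),\mathrm{Im}_{\mathbf{j}}(\omega)\in\mathbb{D}$. $e^\omega=\sum_{n\ge0}\omega^n/n!$,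 and for real $t>0$, $t^{\omega}=e^{\omega\ln t}$. The bicomplex gamma function is $\Gamma(\omega)=\int_0^\infty e^{-t}t^{\omega-1}\,dt$ for $\mathrm{Re}_{\mathbf{j}}(\omega)\gg0$, and the bicomplex zeta function is $\zeta(\omega)=\sum_{n=1}^\infty n^{-\omega}$ for $\mathrm{Re}_{\mathbf{j}}(\omega)\gg1$; both converge absolutely in the finite-dimensional real space $\mathbb{B}$. *)

(* Defs.v *)
From HB Require Import structures.
From mathcomp Require Import all_boot all_order all_algebra.
From mathcomp Require Import ring.
From mathcomp Require Import all_classical all_reals all_analysis.

Set Implicit Arguments.
Unset Strict Implicit.
Unset Printing Implicit Defensive.

Import Order.TTheory GRing.Theory Num.Theory.
Import numFieldNormedType.Exports.
Local Open Scope classical_set_scope.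
Local Open Scope ring_scope.

(* The pair (x, y) stands for x + j y. The alias takes its vector space
   structure and topology from R * R, but not the pointwise product of pairs. *)
Definition hyperbolic (R : realType) : Type := (R * R)%type.

HB.instance Definition _ (R : realType) :=
  NormedModule.copy (hyperbolic R) (R * R)%type.

Section HyperbolicRing.
Variable R : realType.
Implicit Types z w : hyperbolic R.

Definition hyp_one : hyperbolic R := (1, 0).

Definition hyp_mul z w : hyperbolic R :=
  (z.1 * w.1 + z.2 * w.2, z.1 * w.2 + z.2 * w.1).

Fact hyp_mulA : associative hyp_mul.
Proof. by move=> z w u; congr pair => /=; ring. Qed.

Fact hyp_mulC : commutative hyp_mul.
Proof. by move=> z w; congr pair => /=; ring. Qed.

Fact hyp_mul1 : left_id hyp_one hyp_mul.
Proof. by move=> [x y]; congr pair => /=; ring. Qed.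

Fact hyp_mulDl : left_distributive hyp_mul +%R.
Proof. by move=> z w u; congr pair => /=; ring. Qed.

Fact hyp_oner_neq0 : hyp_one != 0.
Proof. by apply/eqP => -[/eqP]; rewrite oner_eq0. Qed.

HB.instance Definition _ := GRing.Zmodule_isComNzRing.Build (hyperbolic R)
  hyp_mulA hyp_mulC hyp_mul1 hyp_mulDl hyp_oner_neq0.

Definition hyp_pi1 z : R := z.1 + z.2.
Definition hyp_pi2 z : R := z.1 - z.2.

Definition hyp_lt z w : Prop :=
  hyp_pi1 z < hyp_pi1 w /\ hyp_pi2 z < hyp_pi2 w.

End HyperbolicRing.

(* The pair (z, w) stands for z + i w, with z and w hyperbolic. *)
Definition bicomplex (R : realType) : Type := (hyperbolic R * hyperbolic R)%type.

HB.instance Definition _ (R : realType) :=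
  NormedModule.copy (bicomplex R) (hyperbolic R * hyperbolic R)%type.

Section BicomplexRing.
Variable R : realType.
Implicit Types u v : bicomplex R.

Definition re_j u : hyperbolic R := u.1.
Definition im_j u : hyperbolic R := u.2.

Definition bc_one : bicomplex R := (1, 0).

Definition bc_mul u v : bicomplex R :=
  (re_j u * re_j v - im_j u * im_j v, re_j u * im_j v + im_j u * re_j v).

Fact bc_mulA : associative bc_mul.
Proof. by move=> u v w; congr pair => /=; rewrite /re_j /im_j /=; ring. Qed.

Fact bc_mulC : commutative bc_mul.
Proof. by move=> u v; congr pair => /=; rewrite /re_j /im_j /=; ring. Qed.

Fact bc_mul1 : left_id bc_one bc_mul.
Proof. by move=> [z w]; congr pair => /=; rewrite /re_j /im_j /=; ring. Qed.

Fact bc_mulDl : left_distributive bc_mul +%R.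
Proof. by move=> u v w; congr pair => /=; rewrite /re_j /im_j /=; ring. Qed.

Fact bc_oner_neq0 : bc_one != 0.
Proof. by apply/eqP => -[/eqP]; rewrite oner_eq0. Qed.

HB.instance Definition _ := GRing.Zmodule_isComNzRing.Build (bicomplex R)
  bc_mulA bc_mulC bc_mul1 bc_mulDl bc_oner_neq0.

Definition bc_of_hyp (z : hyperbolic R) : bicomplex R := (z, 0).
Definition bc_i : bicomplex R := (0, 1).
Definition bc_j : bicomplex R := bc_of_hyp (0, 1).
(* i * k = j and i ^+ 2 = -1 force k = - (i * j). *)
Definition bc_k : bicomplex R := - (bc_i * bc_j).

Lemma bc_mulE u v : u * v = bc_mul u v. Proof. by []. Qed.
Lemma hyp_mulE (z w : hyperbolic R) : z * w = hyp_mul z w. Proof. by []. Qed.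

Lemma bc_i_sqr : bc_i ^+ 2 = -1.
Proof.
rewrite expr2 bc_mulE; congr pair => /=; rewrite ?mulr0 ?mul0r ?mul1r ?addr0 ?sub0r //.
by rewrite oppr0.
Qed.

Lemma bc_j_sqr : bc_j ^+ 2 = 1.
Proof.
rewrite expr2 bc_mulE; congr pair => /=; rewrite ?mulr0 ?mul0r ?subr0 ?addr0 //.
by rewrite hyp_mulE; congr pair => /=; ring.
Qed.

Lemma bc_mulik : bc_i * bc_k = bc_j.
Proof. by rewrite /bc_k mulrN mulrA -expr2 bc_i_sqr mulN1r opprK. Qed.

Lemma bc_k_sqr : bc_k ^+ 2 = -1.
Proof. by rewrite sqrrN exprMn bc_i_sqr bc_j_sqr mulr1. Qed.

Lemma bc_decomp u : u = bc_of_hyp (re_j u) + bc_i * bc_of_hyp (im_j u).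
Proof.
case: u => z w; rewrite bc_mulE /bc_of_hyp /bc_i /re_j /im_j /=.
by congr pair => /=; ring.
Qed.

End BicomplexRing.

Section BicomplexAnalysis.
Variable R : realType.
Implicit Types (u : bicomplex R) (f : R -> bicomplex R) (D : set R) (t : R).

Definition bc_exp u : bicomplex R :=
  limn (series (fun n : nat => (n`!%:R : R)^-1 *: u ^+ n)).

(* t raised to a bicomplex power; meaningful for t > 0. *)
Definition bc_pow t u : bicomplex R := bc_exp (ln t *: u).

(* Lebesgue integrals of the four real coordinates: in a finite-dimensional
   real space this is absolute convergence of the integral. *)
Definition bc_integrable D f : Prop :=
  let mu := @lebesgue_measure R in
  [/\ mu.-integrable D (fun t => ((f t).1.1)%:E),
      mu.-integrable D (fun t => ((f t).1.2)%:E),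
      mu.-integrable D (fun t => ((f t).2.1)%:E)
    & mu.-integrable D (fun t => ((f t).2.2)%:E)].

Definition bc_integral D f : bicomplex R :=
  let mu := @lebesgue_measure R in
  ((\int[mu]_(t in D) (f t).1.1, \int[mu]_(t in D) (f t).1.2),
   (\int[mu]_(t in D) (f t).2.1, \int[mu]_(t in D) (f t).2.2)).

Definition bc_Gamma u : bicomplex R :=
  bc_integral `]0, +oo[ (fun t => expR (- t) *: bc_pow t (u - 1)).

(* Index n stands for the term (n + 1)^(-u). *)
Definition bc_zeta u : bicomplex R :=
  limn (series (fun n : nat => bc_pow n.+1%:R (- u))).

End BicomplexAnalysis.

(* Main.v *)
(** The idempotent components of a bicomplex number turn the ring into two
    copies of the complex numbers, and [Re_j omega >> 1] says that both
    components have real part above 1; so it suffices to prove the classical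
    identity for a complex exponent [x + iy], written in real and imaginary
    parts.  Scaling [t] by [n] gives
    [int e^(-nt) t^(x+iy-1) dt = n^-(x+iy) Gamma(x+iy)], and summing over [n]
    under the integral (dominated convergence, majorant [t^(x-1) / (e^t - 1)])
    yields the integral of [t^(x+iy-1) / (e^t - 1)]. *)

Require Import Defs.
From HB Require Import structures.
From mathcomp Require Import all_boot all_order all_algebra.
From mathcomp Require Import ring lra.
From mathcomp Require Import all_classical all_reals all_analysis.
From mathcomp Require Import measurable_realfun.

Set Implicit Arguments.
Unset Strict Implicit.
Unset Printing Implicit Defensive.

Import Order.TTheory GRing.Theory Num.Theory.
Import numFieldNormedType.Exports.
Local Open Scope classical_set_scope.
Local Open Scope ring_scope.

(** * The complex exponential series in real coordinates *)

(** Termwise domination by [C] times the exponential series at [|M| * |t|]. *)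
Lemma is_cvg_pseries_inv_fact (R : realType) (a : nat -> R) (C M t : R) :
  (forall n, `|a n| <= C * M ^+ n) ->
  cvgn (pseries (fun n => a n / n`!%:R) t).
Proof.
move=> aM; have C0 : 0 <= C.
  by have := aM 0%N; rewrite expr0 mulr1; apply: le_trans.
apply: normed_cvg.
apply: (@series_le_cvg _ _ (fun n => C * exp_coeff (`|M| * `|t|) n)).
- by move=> n; rewrite normr_ge0.
- by move=> n; rewrite mulr_ge0// exp_coeff_ge0// mulr_ge0.
- move=> n; rewrite /= normrM normrX normrM normfV normr_nat.
  rewrite /exp_coeff/= exprMn mulrAC !mulrA.
  rewrite ler_wpM2r ?invr_ge0// ler_wpM2r ?exprn_ge0//.
  apply: le_trans (aM n) _; rewrite ler_wpM2l// -normrX.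
  exact: ler_norm.
- rewrite -[X in series X]/(C *: exp_coeff (`|M| * `|t|)).
  exact/is_cvg_seriesZ/is_cvg_series_exp_coeff.
Qed.

(** Since (n+1)/(n+1)! = 1/n!, termwise differentiation is a mere shift of the coefficients; this is
    what turns a recurrence on [a] into a differential equation. *)
Lemma pseries_diffs_div_fact (R : realType) (a : nat -> R) :
  pseries_diffs (fun n => a n / n`!%:R) = (fun n => a n.+1 / n`!%:R).
Proof.
apply/funext => n; rewrite /pseries_diffs factS natrM invfM.
by rewrite mulrCA mulVKf ?pnatr_eq0.
Qed.

(** Shifting preserves a geometric bound up to the constant, so the first and second derived series
    converge too, which is what differentiation under the sum requires. *)
Lemma is_derive_pseries_inv_fact (R : realType) (a : nat -> R) (C M t : R) :
  (forall n, `|a n| <= C * M ^+ n) ->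
  is_derive t 1 (fun s => limn (pseries (fun n => a n / n`!%:R) s))
    (limn (pseries (fun n => a n.+1 / n`!%:R) t)).
Proof.
move=> aM.
have aM1 n : `|a n.+1| <= C * M * M ^+ n by rewrite -mulrA -exprS aM.
have aM2 n : `|a n.+2| <= C * M * M * M ^+ n by rewrite -mulrA -exprS aM1.
rewrite -pseries_diffs_div_fact; apply: (@pseries_snd_diffs _ _ (`|t| + 1)).
- exact: is_cvg_pseries_inv_fact aM.
- rewrite pseries_diffs_div_fact; exact: is_cvg_pseries_inv_fact aM1.
- rewrite !pseries_diffs_div_fact.
  exact: is_cvg_pseries_inv_fact aM2.
- by rewrite [ltRHS]ger0_norm ?ltrDl ?addr_ge0.
Qed.

(* The recurrences say [a n + i b n = (x + iy)^n].  The two power series solve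
   the linear ODE of [exp (t (x + iy))]; multiplying by [exp (- t (x + iy))]
   gives a constant. *)
Lemma series_complex_exp (R : realType) (a b : nat -> R) (x y : R) :
  a 0%N = 1 -> b 0%N = 0 ->
  (forall n, a n.+1 = x * a n - y * b n) ->
  (forall n, b n.+1 = x * b n + y * a n) ->
  (series (fun n => a n / n`!%:R) @ \oo --> expR x * cos y) /\
  (series (fun n => b n / n`!%:R) @ \oo --> expR x * sin y).
Proof.
move=> a0 b0 aS bS.
(* The recurrences couple [a] and [b], so the induction bounds both at once. *)
have abM n : `|a n| + `|b n| <= (`|x| + `|y|) ^+ n.
  elim: n => [|n IHn]; first by rewrite a0 b0 normr0 normr1 addr0 expr0.
  rewrite aS bS exprS.
  apply: le_trans (_ : (`|x| + `|y|) * (`|a n| + `|b n|) <= _); last first.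
    by rewrite ler_wpM2l// addr_ge0.
  have h1 := ler_normB (x * a n) (y * b n).
  have h2 := ler_normD (x * b n) (y * a n).
  apply: le_trans (lerD h1 h2) _; rewrite !normrM.
  by rewrite le_eqVlt; apply/orP; left; apply/eqP; ring.
have aM n : `|a n| <= 1 * (`|x| + `|y|) ^+ n.
  by rewrite mul1r; apply: le_trans (abM n); rewrite lerDl.
have bM n : `|b n| <= 1 * (`|x| + `|y|) ^+ n.
  by rewrite mul1r; apply: le_trans (abM n); rewrite lerDr.
pose f (t : R) : R := limn (pseries (fun n => a n / n`!%:R) t).
pose g (t : R) : R := limn (pseries (fun n => b n / n`!%:R) t).
have cf t := is_cvg_pseries_inv_fact (t:=t) aM.
have cg t := is_cvg_pseries_inv_fact (t:=t) bM.
have df (t : R) : is_derive t 1 f (x * f t - y * g t).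
  apply: is_derive_eq; first exact: is_derive_pseries_inv_fact aM.
  apply/cvg_lim => //.
  rewrite [X in X @ _](_ : _ = (fun n => x * pseries (fun n => a n / n`!%:R) t n
      - y * pseries (fun n => b n / n`!%:R) t n)).
    exact: (cvgB (cvgM (cvg_cst _) (cf t)) (cvgM (cvg_cst _) (cg t))).
  apply/funext => n; rewrite /pseries /series/= !mulr_sumr -sumrB.
  by apply: eq_bigr => i _; rewrite aS; ring.
have dg (t : R) : is_derive t 1 g (x * g t + y * f t).
  apply: is_derive_eq; first exact: is_derive_pseries_inv_fact bM.
  apply/cvg_lim => //.
  rewrite [X in X @ _](_ : _ = (fun n => x * pseries (fun n => b n / n`!%:R) t n
      + y * pseries (fun n => a n / n`!%:R) t n)).
    exact: (cvgD (cvgM (cvg_cst _) (cg t)) (cvgM (cvg_cst _) (cf t))).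
  apply/funext => n; rewrite /pseries /series/= !mulr_sumr -big_split/=.
  by apply: eq_bigr => i _; rewrite bS; ring.
have f0 : f 0 = 1.
  (* The partial sum of index 0 is empty; from index 1 on, only the constant term survives at 0. *)
  apply/cvg_lim => //; rewrite -(cvg_shiftS _)/=.
  apply: cvg_near_cst; near=> n.
  rewrite /pseries /series/= big_nat_recl//= expr0 mulr1 a0 fact0 divr1.
  by rewrite big1 ?addr0// => i _; rewrite expr0n mulr0.
have g0 : g 0 = 0.
  apply/cvg_lim => //; rewrite -(cvg_shiftS _)/=.
  apply: cvg_near_cst; near=> n.
  rewrite /pseries /series/= big_nat_recl//= expr0 mulr1 b0 mul0r add0r.
  by rewrite big1// => i _; rewrite expr0n mulr0.
(* [h] and [k] are the real and imaginary parts of (f + ig)(t) exp(-t(x + iy)). *)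
pose h (t : R) : R :=
  expR (- (x * t)) * (f t * cos (y * t) + g t * sin (y * t)).
pose k (t : R) : R :=
  expR (- (x * t)) * (g t * cos (y * t) - f t * sin (y * t)).
have dh (t : R) : is_derive t 1 h 0.
  apply: is_derive_eq; rewrite /GRing.scale/=; ring.
have dk (t : R) : is_derive t 1 k 0.
  apply: is_derive_eq; rewrite /GRing.scale/=; ring.
have h1 : h 1 = 1.
  rewrite (is_derive_0_is_cst 1 0 dh) /h f0 g0 !mulr0 oppr0 expR0 cos0 sin0.
  by ring.
have k1 : k 1 = 0.
  rewrite (is_derive_0_is_cst 1 0 dk) /k f0 g0 !mulr0 oppr0 expR0 cos0 sin0.
  by ring.
have e1 : expR x * expR (- x) = 1 by rewrite expRxMexpNx_1.
have ex0 : expR (- x) != 0 by rewrite expR_eq0.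
have cs1 := cos2Dsin2 y.
move: h1 k1; rewrite /h /k !mulr1 => h1 k1.
(* At t = 1 the constancy of [h] and [k] says that rotating (f 1, g 1) by -y gives (e^x, 0); cos^2 +
   sin^2 = 1 undoes the rotation below. *)
have fgx : f 1 * cos y + g 1 * sin y = expR x.
  by apply: (mulfI ex0); rewrite h1 mulrC e1.
have gfx : g 1 * cos y - f 1 * sin y = 0.
  by apply: (mulfI ex0); rewrite k1 mulr0.
have series1 (u : nat -> R) : series (fun n => u n / n`!%:R) =
    pseries (fun n => u n / n`!%:R) 1.
  by rewrite /pseries; congr series; apply/funext => n /=; rewrite expr1n mulr1.
rewrite !series1; split.
  have -> : expR x * cos y = f 1.
    transitivity (f 1 * (cos y ^+ 2 + sin y ^+ 2)); last by rewrite cs1 mulr1.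
    rewrite -fgx; transitivity (f 1 * (cos y ^+ 2 + sin y ^+ 2) +
      sin y * (g 1 * cos y - f 1 * sin y)); first by ring.
    by rewrite gfx mulr0 addr0.
  exact: cf.
have -> : expR x * sin y = g 1.
  transitivity (g 1 * (cos y ^+ 2 + sin y ^+ 2)); last by rewrite cs1 mulr1.
  rewrite -fgx; transitivity (g 1 * (cos y ^+ 2 + sin y ^+ 2) -
    cos y * (g 1 * cos y - f 1 * sin y)); first by ring.
  by rewrite gfx mulr0 subr0.
exact: cg.
Unshelve. all: by end_near. Qed.

(** * Idempotent coordinates on the bicomplex numbers *)

(* [idem_re b u + i * idem_im b u] is the component of [u] along [e_1] for
   [b = false] and along [e_2] for [b = true]. *)
Definition idem_re {R : realType} (b : bool) (u : bicomplex R) : R :=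
  u.1.1 + (-1) ^+ b * u.1.2.
Definition idem_im {R : realType} (b : bool) (u : bicomplex R) : R :=
  u.2.1 + (-1) ^+ b * u.2.2.

(** Inverse of the idempotent coordinates; the halves come from e_1 = (1 + j)/2 and e_2 = (1 -
    j)/2. *)
Definition of_idem {R : realType} (p q : bool -> R) : bicomplex R :=
  (((p false + p true) / 2, (p false - p true) / 2),
   ((q false + q true) / 2, (q false - q true) / 2)).

Section Idempotent_coordinates.
Variable R : realType.
Implicit Types (u v : bicomplex R) (b : bool) (c : R).

Lemma of_idemK u : of_idem (idem_re^~ u) (idem_im^~ u) = u.
Proof.
case: u => [[u11 u12] [u21 u22]].
rewrite /of_idem /idem_re /idem_im/= expr0 expr1.
by congr (pair (pair _ _) (pair _ _)); field.
Qed.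

Lemma idem_re_of_idem b (p q : bool -> R) : idem_re b (of_idem p q) = p b.
Proof. by case: b; rewrite /idem_re /= ?expr0 ?expr1; field. Qed.

Lemma idem_im_of_idem b (p q : bool -> R) : idem_im b (of_idem p q) = q b.
Proof. by case: b; rewrite /idem_im /= ?expr0 ?expr1; field. Qed.

Lemma idem_inj u v : (forall b, idem_re b u = idem_re b v) ->
  (forall b, idem_im b u = idem_im b v) -> u = v.
Proof.
move=> uvr uvi; rewrite -(of_idemK u) -(of_idemK v).
by congr of_idem; apply/funext.
Qed.

Lemma idem_reM b u v :
  idem_re b (u * v) = idem_re b u * idem_re b v - idem_im b u * idem_im b v.
Proof.
case: u v => [[u11 u12] [u21 u22]] [[v11 v12] [v21 v22]].
by rewrite /idem_re /idem_im/=; case: b; rewrite ?expr0 ?expr1; ring.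
Qed.

Lemma idem_imM b u v :
  idem_im b (u * v) = idem_re b u * idem_im b v + idem_im b u * idem_re b v.
Proof.
case: u v => [[u11 u12] [u21 u22]] [[v11 v12] [v21 v22]].
by rewrite /idem_re /idem_im/=; case: b; rewrite ?expr0 ?expr1; ring.
Qed.

Lemma idem_re1 b : idem_re b (1 : bicomplex R) = 1.
Proof. by rewrite /idem_re /= mulr0 addr0. Qed.

Lemma idem_im1 b : idem_im b (1 : bicomplex R) = 0.
Proof. by rewrite /idem_im /= mulr0 addr0. Qed.

Lemma idem_reD b u v : idem_re b (u + v) = idem_re b u + idem_re b v.
Proof. by rewrite /idem_re /=; ring. Qed.

Lemma idem_imD b u v : idem_im b (u + v) = idem_im b u + idem_im b v.
Proof. by rewrite /idem_im /=; ring. Qed.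

Lemma idem_reN b u : idem_re b (- u) = - idem_re b u.
Proof. by rewrite /idem_re /=; ring. Qed.

Lemma idem_imN b u : idem_im b (- u) = - idem_im b u.
Proof. by rewrite /idem_im /=; ring. Qed.

Lemma idem_reZ b c u : idem_re b (c *: u) = c * idem_re b u.
Proof. by rewrite /idem_re mulrDr mulrCA. Qed.

Lemma idem_imZ b c u : idem_im b (c *: u) = c * idem_im b u.
Proof. by rewrite /idem_im mulrDr mulrCA. Qed.

Lemma idem_re_series b (u_ : nat -> bicomplex R) :
  idem_re b \o series u_ = series (idem_re b \o u_).
Proof.
apply/funext => n; rewrite /series/=.
elim/big_rec2 : _ => [|i x y _ <-]; first by rewrite /idem_re /= mulr0 addr0.
exact: idem_reD.
Qed.

Lemma idem_im_series b (u_ : nat -> bicomplex R) :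
  idem_im b \o series u_ = series (idem_im b \o u_).
Proof.
apply/funext => n; rewrite /series/=.
elim/big_rec2 : _ => [|i x y _ <-]; first by rewrite /idem_im /= mulr0 addr0.
exact: idem_imD.
Qed.

(** [of_idem] is built from continuous real operations, so coordinatewise limits assemble, and the
    limit is unique because the space is Hausdorff. *)
Lemma lim_of_idem (u_ : nat -> bicomplex R) (p q : bool -> R) :
  (forall b, idem_re b \o u_ @ \oo --> p b) ->
  (forall b, idem_im b \o u_ @ \oo --> q b) ->
  limn u_ = of_idem p q.
Proof.
move=> up uq.
apply/cvg_lim; first exact: norm_hausdorff.
have -> : u_ = fun n => of_idem (idem_re^~ (u_ n)) (idem_im^~ (u_ n)).
  by apply/funext => n; rewrite of_idemK.
exact: (cvg_pair
  (cvg_pair (cvgM (cvgD (up false) (up true)) (cvg_cst _))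
            (cvgM (cvgB (up false) (up true)) (cvg_cst _)))
  (cvg_pair (cvgM (cvgD (uq false) (uq true)) (cvg_cst _))
            (cvgM (cvgB (uq false) (uq true)) (cvg_cst _)))).
Qed.

(** In each component the coordinates of [u ^+ n] obey the recurrences of the powers of a complex
    number, so [series_complex_exp] applies. *)
Lemma bc_exp_idem u : bc_exp u = of_idem
  (fun b => expR (idem_re b u) * cos (idem_im b u))
  (fun b => expR (idem_re b u) * sin (idem_im b u)).
Proof.
have cvg_coord b :
    (series (fun n => idem_re b (u ^+ n) / n`!%:R) @ \oo -->
      expR (idem_re b u) * cos (idem_im b u)) /\
    (series (fun n => idem_im b (u ^+ n) / n`!%:R) @ \oo -->
      expR (idem_re b u) * sin (idem_im b u)).
  apply: series_complex_exp => [||n|n].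
  - exact: idem_re1.
  - exact: idem_im1.
  - by rewrite exprS idem_reM.
  - by rewrite exprS idem_imM.
apply: lim_of_idem => b; rewrite ?idem_re_series ?idem_im_series.
- rewrite [X in series X](_ : _ = fun n => idem_re b (u ^+ n) / n`!%:R).
    exact: (cvg_coord b).1.
  by apply/funext => n /=; rewrite idem_reZ mulrC.
- rewrite [X in series X](_ : _ = fun n => idem_im b (u ^+ n) / n`!%:R).
    exact: (cvg_coord b).2.
  by apply/funext => n /=; rewrite idem_imZ mulrC.
Qed.

End Idempotent_coordinates.

(** * The substitution t -> ct on the half-line *)

Section Scaling.
Variable R : realType.
Notation mu := (@lebesgue_measure R).
Local Open Scope ereal_scope.

(** By uniqueness of Lebesgue measure: [c] times the pushforward gives each interval ]a, b] its
    length. *)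
Lemma lebesgue_measure_scale (c : {posnum R}) (A : set R) : measurable A ->
  pushforward mu ( *%R c%:num : _ -> measurableTypeR R) A =
  mscale (c%:num^-1%:nng)%R mu A.
Proof.
move=> mA.
have muA : mu A =
    c%:num%:E * pushforward mu ( *%R c%:num : _ -> measurableTypeR R) A.
  apply: (@lebesgue_measure_unique R (mscale (c%:num%:nng)%R
    (pushforward mu ( *%R c%:num : _ -> measurableTypeR R)))) => //.
  move=> _ [[a b] _ <-].
  rewrite /= /mscale/= /pushforward.
  have -> : *%R c%:num @^-1` `]a, b] =
      `](a / c%:num)%R, (b / c%:num)%R]%classic.
    apply/seteqP; split => x/=; rewrite !in_itv/=.
      by rewrite ltr_pdivrMr// ler_pdivlMr// mulrC.
    by rewrite ltr_pdivrMr// ler_pdivlMr// mulrC.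
  rewrite !lebesgue_measure_itv/= !lte_fin ltr_pM2r//.
  case: ifPn => ab; last by rewrite mule0.
  by rewrite -!EFinB -EFinM -mulrBl mulrC divfK.
transitivity ((c%:num^-1)%:E * mu A); last by [].
by rewrite muA muleA -EFinM mulVf// mul1e.
Qed.

(** Integration against the pushforward measure; the half-line is its own preimage under scaling by
    a positive number. *)
Lemma ge0_integral_scale (c : {posnum R}) (f : R -> \bar R) :
  measurable_fun [set: R] f -> (forall t, 0 <= f t) ->
  \int[mu]_(t in `]0%R, +oo[) f (c%:num * t)%R =
  (c%:num^-1)%:E * \int[mu]_(t in `]0%R, +oo[) f t.
Proof.
move=> mf f0.
rewrite [X in \int[_]_(_ in X) f (_ * _)%R](_ : _ =
    ( *%R c%:num : _ -> measurableTypeR R) @^-1` `]0%R, +oo[); last first.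
  by apply/seteqP; split => x/=; rewrite !in_itv/= !andbT pmulr_rgt0.
rewrite -[LHS]ge0_integral_pushforward//; last exact: measurable_funTS.
rewrite -[RHS](@ge0_integral_mscale _ _ _ _ _ _ (c%:num^-1%:nng)%R)//;
  last exact: measurable_funTS.
by apply: eq_measure_integral => A mA _; exact: lebesgue_measure_scale.
Qed.

(** Reduces to the positive and negative parts, whose integrals are finite, so that their difference
    is well defined and scales. *)
Lemma integral_scale (c : {posnum R}) (f : R -> R) :
  measurable_fun [set: R] f ->
  mu.-integrable `]0%R, +oo[ (EFin \o f) ->
  (\int[mu]_(t in `]0%R, +oo[) f (c%:num * t) =
    c%:num^-1 * \int[mu]_(t in `]0%R, +oo[) f t)%R.
Proof.
move=> mf intf.
have mEf : measurable_fun [set: R] (EFin \o f) by exact/measurable_EFinP.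
have fpos := integrable_pos_fin_num _ intf.
have fneg := integrable_neg_fin_num _ intf.
have J : (\int[mu]_(t in `]0%R, +oo[) (f (c%:num * t)%R)%:E =
    (c%:num^-1)%:E * \int[mu]_(t in `]0%R, +oo[) (f t)%:E)%E.
  rewrite [in LHS]integralE [in RHS]integralE muleBr//; last first.
    by apply: fin_num_adde_defr; exact: fpos.
  rewrite -!ge0_integral_scale//.
  - by congr (_ - _); apply: eq_integral => t _; rewrite unlock.
  - exact: measurable_funeneg.
  - exact: measurable_funepos.
by rewrite /Rintegral J fineM//; exact: integrable_fin_num.
Qed.

End Scaling.

(** * Integrability of t^(x-1) / (e^t - 1) for x > 1 *)

Section Majorant.
Variable R : realType.
Notation mu := (@lebesgue_measure R).
Implicit Types (t x : R).

Lemma measurable_fun_itvoy (f : R -> R) :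
  (forall t, 0 < t -> {for t, continuous f}) ->
  measurable_fun (`]0, +oo[ : set R) f.
Proof.
move=> cf; apply: open_continuous_measurable_fun; first exact: interval_open.
by move=> t; rewrite inE/= in_itv/= andbT => t0; exact: cf.
Qed.

(** On [1/(n+1), +oo[ the fundamental theorem gives the integral l - F(1/(n+1)) <= l, whatever [F]
    does near 0; monotone convergence along these sets carries the bound [l] to the half-line. *)
Lemma integrable_derive_itvoy (f F : R -> R) (l : R) :
  (forall t, 0 < t -> {for t, continuous f}) ->
  (forall t, 0 < t -> 0 <= f t) ->
  (forall t, 0 < t -> is_derive t 1 F (f t)) ->
  (forall t, 0 < t -> 0 <= F t) ->
  F t @[t --> +oo] --> l ->
  mu.-integrable `]0, +oo[ (EFin \o f).
Proof.
move=> cf f0 dF F0 Fl.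
have mf := measurable_fun_itvoy cf.
apply/integrableP; split; first exact/measurable_EFinP.
pose E n : set R := `[n.+1%:R^-1, +oo[%classic.
have EU : \bigcup_n E n = `]0, +oo[%classic.
  apply/seteqP; split => t /=.
    by move=> [n _]; rewrite /E/= !in_itv/= !andbT; apply: lt_le_trans.
  rewrite in_itv/= andbT => t0.
  (* The index n = floor(1/t) satisfies 1/t < n + 1, hence 1/(n+1) <= t. *)
  exists (Num.truncn t^-1) => //; rewrite /E/= in_itv/= andbT.
  rewrite invf_ple ?posrE//.
  by apply/ltW; exact: Num.Theory.truncnS_gt.
have Epos n t : E n t -> 0 < t.
  by rewrite /E/= in_itv/= andbT; apply: lt_le_trans.
have mE n : measurable_fun (E n) (EFin \o f).
  apply/measurable_EFinP; apply: measurable_funS mf => //.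
  by move=> t /Epos; rewrite /= in_itv/= andbT.
apply: (@le_lt_trans _ _ l%:E); last exact: ltry.
rewrite (_ : (\int[mu]_(t in `]0%R, +oo[) `|(EFin \o f) t|)%E =
    (\int[mu]_(t in \bigcup_n E n) (EFin \o f) t)%E); last first.
  rewrite EU; apply: eq_integral => t; rewrite inE/= in_itv/= andbT => t0.
  by rewrite ger0_norm// f0.
have cvgE := @ge0_nondecreasing_set_cvg_integral _ (measurableTypeR R) R E
  (EFin \o f) mu.
apply: (cvge_to_le (cvgE _ _ _ _)) => //.
- apply/nondecreasing_seqP => n; apply/subsetPset => t.
  rewrite /E/= !in_itv/= !andbT.
  by apply: le_trans; rewrite lef_pV2 ?posrE// ler_nat.
- by move=> n; exact: measurable_itv.
- by move=> n t /Epos t0; rewrite lee_fin f0.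
apply: nearW => n.
have n0 : 0 < n.+1%:R^-1 :> R by rewrite invr_gt0.
rewrite (@ge0_continuous_FTC2y _ f F _ l) //.
- by rewrite -EFinB lee_fin lerBlDr lerDl F0.
- by move=> t nt; apply: f0; apply: lt_le_trans nt.
- apply/continuous_within_itvcyP; split.
    move=> t; rewrite in_itv/= andbT => nt; apply: cf; exact: lt_trans nt.
  by apply: cvg_at_right_filter; exact: cf.
- by move=> t nt; have [] := dF t (lt_trans n0 nt).
- apply: cvg_at_right_filter.
  apply: differentiable_continuous; apply/derivable1_diffP.
  by have [] := dF _ n0.
- move=> t; rewrite in_itv/= andbT => nt.
  by rewrite derive1E; have := dF t (lt_trans n0 nt) => ?; rewrite derive_val.
Qed.

Lemma expR_subr1_gt0 t : 0 < t -> 0 < expR t - 1.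
Proof. by move=> t0; rewrite subr_gt0 expR_gt1. Qed.

Lemma continuous_expR_subr1V t : 0 < t ->
  {for t, continuous (fun s : R => (expR s - 1)^-1)}.
Proof.
move=> t0; apply: cvgV; first by rewrite gt_eqF// expR_subr1_gt0.
by apply: cvgB; [exact: continuous_expR|exact: cvg_cst].
Qed.

(* [e^t - 1 >= (t/2) e^(t/2)], and [ln z <= z - 1] at [z = (1 + t) / (2 x)]
   bounds [(1 + t)^x] by a multiple of [e^(t/2)].  Up to a constant, the
   right-hand side is the derivative of the bounded function
   [(t / (1 + t))^(x - 1)]. *)
Lemma bose_le x t : 1 < x -> 0 < t ->
  (expR t - 1)^-1 * expR ((x - 1) * ln t) <=
  2 * expR (x * ln (2 * x) + 2^-1) *
    (expR ((x - 1) * (ln t - ln (1 + t))) * (t^-1 - (1 + t)^-1)).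
Proof.
move=> x1 t0; have x0 : 0 < x by apply: lt_trans x1.
have t1 : 0 < 1 + t by rewrite addr_gt0.
have e2 : expR t = expR (t / 2) * expR (t / 2) by rewrite -expRD -splitr.
have le1 : t / 2 * expR (t / 2) <= expR t - 1.
  have := expR_ge1Dx (t / 2); have := expR_gt0 (t / 2); rewrite e2; nra.
have le2 : x * ln (1 + t) <= x * ln (2 * x) + 2^-1 + t / 2.
  have x20 : 0 < 2 * x by rewrite mulr_gt0.
  have : ln ((1 + t) / (2 * x)) <= (1 + t) / (2 * x) - 1.
    have := @le_ln1Dx R ((1 + t) / (2 * x) - 1).
    rewrite addrCA subrr addr0; apply.
    by rewrite ltrBrDr addNr divr_gt0.
  rewrite ln_div ?posrE// => /(ler_wpM2l (ltW x0)).
  rewrite mulrBr mulrBr mulr1.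
  have -> : x * ((1 + t) / (2 * x)) = (1 + t) / 2 by field; rewrite gt_eqF.
  lra.
have -> : t^-1 - (1 + t)^-1 = t^-1 * expR (- ln (1 + t)).
  rewrite expRN lnK ?posrE//; field.
  by rewrite !gt_eqF.
(* With t^(x-1) factored out of both sides, [le2] bounds the remaining right factor below by (2/t)
   e^(-t/2), and [le1] is the comparison of this with 1/(e^t - 1). *)
rewrite [leRHS](_ : _ = expR ((x - 1) * ln t) *
  ((t / 2)^-1 * expR (x * ln (2 * x) + 2^-1 - x * ln (1 + t)))); last first.
  rewrite invf_div.
  have -> : (x - 1) * (ln t - ln (1 + t)) =
    (x - 1) * ln t - x * ln (1 + t) + ln (1 + t) by ring.
  rewrite !expRD !expRN.
  by field; rewrite !gt_eqF ?expR_gt0.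
rewrite mulrC ler_wpM2l ?expR_ge0//.
apply: (@le_trans _ _ ((t / 2)^-1 * expR (- (t / 2)))); last first.
  apply: ler_wpM2l; first by rewrite invr_ge0 ltW// divr_gt0.
  by rewrite ler_expR; lra.
rewrite expRN -invfM lef_pV2 ?posrE ?expR_subr1_gt0//.
by rewrite mulr_gt0 ?divr_gt0 ?expR_gt0.
Qed.

Lemma integrable_bose x : 1 < x -> mu.-integrable `]0, +oo[
  (fun t => ((expR t - 1)^-1 * expR ((x - 1) * ln t))%:E).
Proof.
move=> x1; set K := 2 * expR (x * ln (2 * x) + 2^-1).
(* [E t] is (t/(1+t))^(x-1); its derivative is (x-1) E(t) (1/t - 1/(1+t)), and it tends to 1 at
   infinity. Hence the primitive K/(x-1) E and its limit K/(x-1) below. *)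
pose E t := expR ((x - 1) * (ln t - ln (1 + t))).
have p0 : 0 < x - 1 by rewrite subr_gt0.
have t10 t : 0 < t -> 0 < 1 + t by move=> t0; rewrite addr_gt0.
have cE t : 0 < t -> {for t, continuous E}.
  move=> t0; apply: continuous_comp; last exact: continuous_expR.
  apply: cvgM; first exact: cvg_cst.
  apply: cvgB; first exact: continuous_ln.
  apply: continuous_comp; last exact/continuous_ln/t10.
  by apply: cvgD; [exact: cvg_cst|exact: cvg_id].
have : mu.-integrable `]0, +oo[
    (EFin \o (fun t => K * (E t * (t^-1 - (1 + t)^-1)))).
  apply: (@integrable_derive_itvoy (fun t => K * (E t * (t^-1 - (1 + t)^-1)))
    (fun t => K / (x - 1) * E t) (K / (x - 1) * 1)).
  - move=> t t0; apply: cvgM; first exact: cvg_cst.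
    apply: cvgM; first exact: cE.
    apply: cvgB; apply: cvgV; rewrite ?gt_eqF// ?t10//.
    by apply: cvgD; [exact: cvg_cst|exact: cvg_id].
  - move=> t t0; rewrite mulr_ge0 ?mulr_ge0 ?expR_ge0//.
    by rewrite subr_ge0 lef_pV2 ?posrE ?t10// lerDr.
  - move=> t t0.
    have dln := is_derive1_ln t0; have dln1 := is_derive1_ln (t10 _ t0).
    apply: is_derive_eq.
    rewrite /GRing.scale/= -/(E t) add0r mulr1.
    by field; rewrite !gt_eqF ?t10.
  - move=> t t0; rewrite mulr_ge0 ?expR_ge0// divr_ge0 ?ltW//.
    by rewrite mulr_gt0 ?expR_gt0.
  apply: cvgM; first exact: cvg_cst.
  rewrite -expR0; apply: continuous_cvg; first exact: continuous_expR.
  rewrite -[X in _ --> X](mulr0 (x - 1)); apply: cvgM; first exact: cvg_cst.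
  (* ln t - ln(1+t) is rewritten as -ln(1 + 1/t) to read off its limit 0. *)
  have : - ln (1 + t^-1) @[t --> +oo] --> - ln (1 + 0 : R).
    apply: cvgN; apply: (@cvg_comp _ _ _ (fun t : R => 1 + t^-1) (@ln R) _
      (nbhs (1 + 0 : R))).
      apply: cvgD; first exact: cvg_cst.
      by apply/gtr0_cvgV0; [exact: nbhs_pinfty_gt|exact: cvg_id].
    by apply: continuous_ln; rewrite addr0.
  rewrite addr0 ln1 oppr0; apply: cvg_trans; apply: near_eq_cvg; near=> t.
  have t0 : 0 < t by near: t; exact: nbhs_pinfty_gt.
  rewrite -[RHS]opprB -ln_div ?posrE ?t10//.
  by rewrite mulrDl mul1r divff ?gt_eqF// addrC.
move=> gi; apply: le_integrable gi; first exact: measurable_itv.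
- apply/measurable_EFinP; apply: measurable_fun_itvoy => t t0.
  apply: cvgM; first exact: continuous_expR_subr1V.
  apply: continuous_comp; last exact: continuous_expR.
  by apply: cvgM; [exact: cvg_cst|exact: continuous_ln].
- move=> t; rewrite /= in_itv/= andbT => t0.
  rewrite lee_fin ger0_norm; last first.
    by rewrite mulr_ge0 ?expR_ge0// invr_ge0 ltW// expR_subr1_gt0.
  by apply: le_trans (bose_le x1 t0) _; exact: ler_norm.
Unshelve. all: by end_near. Qed.

End Majorant.

(** * Mellin integrals and summation under the integral sign *)

(* The real and imaginary parts of [t^(x + iy - 1)] are the cases
   [h = fun s => cos (s * y)] and [h = fun s => sin (s * y)]. *)
Definition mellin_kernel {R : realType} (x : R) (h : R -> R) (t : R) : R :=
  expR ((x - 1) * ln t) * h (ln t).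

Section Mellin.
Variables (R : realType) (x : R) (h : R -> R).
Notation mu := (@lebesgue_measure R).
Hypotheses (x1 : 1 < x) (mh : measurable_fun [set: R] h)
  (h1 : forall s, `|h s| <= 1).
Implicit Types t c : R.

Lemma measurable_mellin_kernel : measurable_fun [set: R] (mellin_kernel x h).
Proof.
apply: measurable_funM.
  apply: measurableT_comp; first exact: measurable_expR.
  by apply: measurable_funM => //; exact: measurable_ln.
by apply: measurableT_comp => //; exact: measurable_ln.
Qed.

Lemma norm_mellin_kernel_le t : `|mellin_kernel x h t| <= expR ((x - 1) * ln t).
Proof. by rewrite normrM ger0_norm ?expR_ge0// ler_piMr ?expR_ge0. Qed.

(** The weight [w] is left general to serve 1/(e^t - 1), the single exponentials e^(-ct) and their
    partial sums alike. *)
Lemma integrable_mellin_kernel (w : R -> R) :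
  measurable_fun (`]0, +oo[ : set R) w ->
  (forall t, 0 < t -> `|w t| <= (expR t - 1)^-1) ->
  mu.-integrable `]0, +oo[ (EFin \o (fun t => w t * mellin_kernel x h t)).
Proof.
move=> mw w1; have := integrable_bose x1.
move=> gi; apply: le_integrable gi; first exact: measurable_itv.
  apply/measurable_EFinP; apply: measurable_funM => //.
  by apply: measurable_funTS; exact: measurable_mellin_kernel.
move=> t; rewrite /= in_itv/= andbT => t0.
rewrite lee_fin normrM [leRHS]normrM; apply: ler_pM => //.
  by rewrite [leRHS]ger0_norm ?w1// invr_ge0 ltW// expR_subr1_gt0.
by rewrite [leRHS]ger0_norm ?expR_ge0// norm_mellin_kernel_le.
Qed.

Lemma integrable_bose_mellin : mu.-integrable `]0, +oo[
  (EFin \o (fun t => (expR t - 1)^-1 * mellin_kernel x h t)).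
Proof.
apply: integrable_mellin_kernel => [|t t0].
  by apply: measurable_fun_itvoy => t t0; exact: continuous_expR_subr1V.
by rewrite ger0_norm// invr_ge0 ltW// expR_subr1_gt0.
Qed.

(** For c >= 1 and t > 0, e^(ct) >= e^t > e^t - 1, so the weight is below 1/(e^t - 1). *)
Lemma integrable_exp_mellin c : 1 <= c -> mu.-integrable `]0, +oo[
  (EFin \o (fun t => expR (- (c * t)) * mellin_kernel x h t)).
Proof.
move=> c1; apply: integrable_mellin_kernel => [|t t0].
  apply: measurable_funTS.
  apply: measurableT_comp; first exact: measurable_expR.
  by apply: measurableT_comp => //; exact: oppr_measurable.
rewrite ger0_norm ?expR_ge0// expRN lef_pV2 ?posrE ?expR_gt0 ?expR_subr1_gt0//.
rewrite lerBlDr -[leLHS]addr0 lerD// ler_expR -[leLHS]mul1r.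
by rewrite ler_wpM2r// ltW.
Qed.

Lemma integrable_exp_mellinN : mu.-integrable `]0, +oo[
  (EFin \o (fun t => expR (- t) * mellin_kernel x h t)).
Proof.
have := integrable_exp_mellin (lexx 1).
by apply: eq_integrable => // t _; rewrite /= mul1r.
Qed.

(** Geometric sum of ratio e^(-t). For t > 0 the first factor lies in [0, 1) and tends to 1, which
    yields both the uniform bound and the limit needed for dominated convergence. *)
Lemma sum_expRN (N : nat) t : 0 < t ->
  \sum_(0 <= n < N) expR (- (n.+1%:R * t)) =
  (1 - expR (- (N%:R * t))) * (expR t - 1)^-1.
Proof.
move=> t0; have e0 : expR t - 1 != 0 by rewrite gt_eqF// expR_subr1_gt0.
elim: N => [|N IHN]; first by rewrite big_geq// mul0r oppr0 expR0 subrr mul0r.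
rewrite big_nat_recr//= IHN -[X in _ + X](mulfK e0) -mulrDl; congr (_ * _).
have -> : expR (- (N%:R * t)) = expR (- (N.+1%:R * t)) * expR t.
  by rewrite -expRD; congr expR; rewrite -natr1; ring.
by ring.
Qed.

Lemma cvg_sum_integral_mellin :
  series (fun n => \int[mu]_(t in `]0, +oo[)
    (expR (- (n.+1%:R * t)) * mellin_kernel x h t)) @ \oo -->
  \int[mu]_(t in `]0, +oo[) ((expR t - 1)^-1 * mellin_kernel x h t).
Proof.
(* The weights are summed before multiplying by the kernel, which may change sign: the bound on the
   weights is then independent of [h]. *)
pose f_ (N : nat) t : R :=
  (\sum_(0 <= n < N) expR (- (n.+1%:R * t))) * mellin_kernel x h t.
have wle N t : 0 < t ->
    `|\sum_(0 <= n < N) expR (- (n.+1%:R * t))| <= (expR t - 1)^-1.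
  move=> t0; have e0 := expR_subr1_gt0 t0.
  rewrite sum_expRN// normrM [X in _ * X]ger0_norm ?invr_ge0 ?(ltW e0)//.
  rewrite -[leRHS]mul1r ler_wpM2r ?invr_ge0 ?(ltW e0)//.
  rewrite ger0_norm ?gerBl ?expR_ge0//.
  by rewrite subr_ge0 -expR0 ler_expR oppr_le0 mulr_ge0// ltW.
have intf N : mu.-integrable `]0, +oo[ (EFin \o f_ N).
  apply: integrable_mellin_kernel (wle N).
  apply: measurable_funTS; apply: measurable_sum => n.
  apply: measurableT_comp; first exact: measurable_expR.
  by apply: measurableT_comp => //; exact: oppr_measurable.
have sumE N : series (fun n => \int[mu]_(t in `]0, +oo[)
    (expR (- (n.+1%:R * t)) * mellin_kernel x h t)) N =
    \int[mu]_(t in `]0, +oo[) f_ N t.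
  elim: N => [|N IHN].
    rewrite /series/= big_geq// /Rintegral integral0_eq// => t _.
    by rewrite /f_ big_geq// mul0r.
  rewrite seriesSr IHN -RintegralD//; last first.
    by apply: integrable_exp_mellin; rewrite ler1n.
  by apply: eq_Rintegral => t _; rewrite /f_ big_nat_recr//= mulrDl.
rewrite [X in X @ _](_ : _ = fun N => \int[mu]_(t in `]0, +oo[) f_ N t);
  last exact/funext.
apply: fine_cvg; rewrite fineK; last first.
  by apply: integrable_fin_num => //; exact: integrable_bose_mellin.
apply: (@dominated_cvg _ (measurableTypeR R) R mu _ (measurable_itv `]0, +oo[)
  (fun N => EFin \o f_ N)
  (EFin \o (fun t => (expR t - 1)^-1 * mellin_kernel x h t))
  (fun t => ((expR t - 1)^-1 * expR ((x - 1) * ln t))%:E)) => //.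
- by move=> N; exact: measurable_int (intf N).
- move=> t; rewrite /= in_itv/= andbT => t0.
  apply: cvg_EFin; first exact: nearW.
  apply: cvgM; last exact: cvg_cst.
  rewrite (_ : (fun N => _) =
      fun N => (1 - expR (- t) ^+ N) * (expR t - 1)^-1); last first.
    by apply/funext => N; rewrite /= sum_expRN// -mulrN expRM_natl.
  have et : `|expR (- t)| < 1.
    by rewrite ger0_norm ?expR_ge0// expR_lt1 oppr_lt0.
  have := cvgM (cvgB (cvg_cst (1 : R)) (cvg_expr et))
    (cvg_cst ((expR t - 1)^-1)).
  by rewrite subr0 mul1r => cvgK; exact: cvgK.
- exact: integrable_bose.
- move=> N t; rewrite /= in_itv/= andbT => t0.
  by rewrite lee_fin normrM ler_pM ?wle ?norm_mellin_kernel_le.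
Qed.

End Mellin.

(** * Extracting the factor n^(-s) from each Mellin integral *)

Section Mellin_scaling.
Variables (R : realType) (x : R).
Notation mu := (@lebesgue_measure R).
Hypothesis x1 : 1 < x.

(** Substitute s = ct: t^(x-1) dt becomes c^(-x) s^(x-1) ds, and ln t = ln s - ln c shifts the
    argument of [h]. *)
Lemma integral_exp_mellin_scale (h : R -> R) c : 1 <= c ->
  measurable_fun [set: R] h -> (forall s, `|h s| <= 1) ->
  \int[mu]_(t in `]0, +oo[) (expR (- (c * t)) * mellin_kernel x h t) =
  expR (- (x * ln c)) * \int[mu]_(t in `]0, +oo[)
    (expR (- t) * mellin_kernel x (fun s => h (s - ln c)) t).
Proof.
move=> c1 mh h1; have c0 : 0 < c by apply: lt_le_trans c1.
set hc := fun s => h (s - ln c).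
have mhc : measurable_fun [set: R] hc.
  by apply: measurableT_comp => //; exact: measurable_funB.
have hc1 s : `|hc s| <= 1 by exact: h1.
pose f t : R := expR (- t) * mellin_kernel x hc t.
have mf : measurable_fun [set: R] f.
  apply: measurable_funM; last exact: measurable_mellin_kernel.
  by apply: measurableT_comp; [exact: measurable_expR|exact: oppr_measurable].
have intf : mu.-integrable `]0, +oo[ (EFin \o f).
  exact: integrable_exp_mellinN.
have := integral_scale (PosNum c0) mf intf; rewrite /= => fE.
(* The factor 1/c is the Jacobian; c^(-(x-1)) cancels the power produced by the kernel at
   [c * t]. *)
have -> : expR (- (x * ln c)) = expR (- ((x - 1) * ln c)) * c^-1.
  by rewrite -[in RHS](lnK (_ : c \is Num.pos)) ?posrE// -expRN -expRD expRK;
    congr expR; ring.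
rewrite -mulrA -fE.
have -> : \int[mu]_(t in `]0, +oo[) f (c * t) = expR ((x - 1) * ln c) *
    \int[mu]_(t in `]0, +oo[) (expR (- (c * t)) * mellin_kernel x h t).
  rewrite -RintegralZl//; last exact: integrable_exp_mellin.
  apply: eq_Rintegral => t; rewrite inE/= in_itv/= andbT => t0.
  rewrite /f /mellin_kernel /hc lnM ?posrE// [ln c + _]addrC addrK.
  by rewrite mulrDr expRD; ring.
by rewrite mulrA -expRD addNr expR0 mul1r.
Qed.

(* The case [h = 1] of [cvg_sum_integral_mellin] reads: the partial sums times
   [Gamma x > 0] converge. *)
Lemma summable_zeta : cvgn (series (fun n => expR (- (x * ln (n.+1%:R : R))))).
Proof.
have m1 : measurable_fun [set: R] (fun _ : R => 1 : R) by [].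
have n1 (s : R) : `|1 : R| <= 1 by rewrite normr1.
have := cvg_sum_integral_mellin x1 m1 n1.
set G := \int[mu]_(t in `]0, +oo[) (expR (- t) * mellin_kernel x (fun=> 1) t).
have -> : (fun n => \int[mu]_(t in `]0, +oo[)
    (expR (- (n.+1%:R * t)) * mellin_kernel x (fun=> 1) t)) =
    (fun n => expR (- (x * ln (n.+1%:R : R))) * G).
  by apply/funext => n; rewrite integral_exp_mellin_scale// ler1n.
(* On [1, 2] the integrand is at least e^(-2), because t <= 2 and t^(x-1) >= 1; so G >= e^(-2) >
   0. *)
have G0 : G != 0.
  have intG := integrable_exp_mellinN x1 m1 n1.
  have sub12 : (`[1, 2] : set R) `<=` `]0, +oo[.
    move=> t; rewrite /= !in_itv/= => /andP[+ _]; rewrite andbT.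
    exact: lt_le_trans.
  rewrite gt_eqF// -lte_fin fineK; last exact: integrable_fin_num.
  apply: (@lt_le_trans _ _ (\int[mu]_(t in `[1%R, 2%R]) (expR (- 2))%:E)%E).
    rewrite integral_cst//= lebesgue_measure_itv/= lte_fin ltr1n.
    by rewrite -EFinB -EFinM lte_fin mulr_gt0 ?expR_gt0// subr_gt0 ltr1n.
  apply: (@le_trans _ _ (\int[mu]_(t in `[1%R, 2%R])
      (expR (- t) * mellin_kernel x (fun=> 1) t)%:E)%E).
    apply: ge0_le_integral => //.
    - by apply: (@measurable_int _ _ _ mu); apply: integrableS intG.
    - move=> t; rewrite /= in_itv/= => /andP[t1 t2].
      rewrite lee_fin /mellin_kernel mulr1 -expRD ler_expR.
      rewrite -[leLHS]addr0 lerD// ?lerN2// mulr_ge0 ?ln_ge0//.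
      by rewrite subr_ge0 ltW.
  apply: ge0_subset_integral => //.
  - exact: measurable_int intG.
  - by move=> t _; rewrite lee_fin /mellin_kernel mulr1 mulr_ge0 ?expR_ge0.
move=> /(cvgM (cvg_cst G^-1)) sG; apply/cvg_ex; eexists; move: sG.
apply: cvg_trans.
apply: near_eq_cvg; apply: nearW => N.
rewrite /series/= mulr_sumr; apply: eq_bigr => n _.
by rewrite mulrCA mulVf// mulr1.
Qed.

End Mellin_scaling.

(** * The identity for a complex exponent, in real and imaginary parts *)

Lemma integrable_lincomb d (T : measurableType d) (R : realType)
    (mu : {measure set T -> \bar R}) (D : set T) (a b : R) (f g : T -> R) :
  measurable D ->
  mu.-integrable D (EFin \o f) -> mu.-integrable D (EFin \o g) ->
  mu.-integrable D (EFin \o (fun t => a * f t + b * g t)).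
Proof.
move=> mD fi gi.
have := integrableD mD (integrableZl mD a fi) (integrableZl mD b gi).
exact: eq_integrable.
Qed.

Lemma Rintegral_lincomb d (T : measurableType d) (R : realType)
    (mu : {measure set T -> \bar R}) (D : set T) (a b : R) (f g : T -> R) :
  measurable D ->
  mu.-integrable D (EFin \o f) -> mu.-integrable D (EFin \o g) ->
  \int[mu]_(t in D) (a * f t + b * g t) =
  a * \int[mu]_(t in D) f t + b * \int[mu]_(t in D) g t.
Proof.
move=> mD fi gi.
have Zi c h : mu.-integrable D (EFin \o h) ->
    mu.-integrable D (EFin \o (fun t => c * h t)).
  by move=> hi; have := integrableZl mD c hi; apply: eq_integrable.
by rewrite RintegralD ?RintegralZl//; exact: Zi.
Qed.

Lemma measurable_cosM (R : realType) (y : R) :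
  measurable_fun [set: R] (fun s : R => cos (s * y)).
Proof.
apply: measurableT_comp; last exact: mulrr_measurable.
by apply: continuous_measurable_fun; exact: continuous_cos.
Qed.

Lemma measurable_sinM (R : realType) (y : R) :
  measurable_fun [set: R] (fun s : R => sin (s * y)).
Proof.
apply: measurableT_comp; last exact: mulrr_measurable.
by apply: continuous_measurable_fun; exact: continuous_sin.
Qed.

Section Complex_case.
Variables (R : realType) (x y : R).
Notation mu := (@lebesgue_measure R).
Hypothesis x1 : 1 < x.

Let cosy (s : R) : R := cos (s * y).
Let siny (s : R) : R := sin (s * y).

(** P + iQ is zeta(x + iy) and A + iB is Gamma(x + iy); the two equations are the real and imaginary
    parts of their product. The sign in [q] comes from n^(-iy) = cos(y ln n) - i sin(y ln n). Both
    series converge absolutely, dominated by [summable_zeta]. *)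
Lemma zeta_gamma_coordinates :
  let p n := expR (- (x * ln (n.+1%:R : R))) * cosy (ln n.+1%:R) in
  let q n := - (expR (- (x * ln (n.+1%:R : R))) * siny (ln n.+1%:R)) in
  let A := \int[mu]_(t in `]0, +oo[) (expR (- t) * mellin_kernel x cosy t) in
  let B := \int[mu]_(t in `]0, +oo[) (expR (- t) * mellin_kernel x siny t) in
  exists P Q : R, [/\ series p @ \oo --> P, series q @ \oo --> Q,
    P * A - Q * B =
      \int[mu]_(t in `]0, +oo[) ((expR t - 1)^-1 * mellin_kernel x cosy t) &
    P * B + Q * A =
      \int[mu]_(t in `]0, +oo[) ((expR t - 1)^-1 * mellin_kernel x siny t)].
Proof.
move=> p q A B.
have mcosy : measurable_fun [set: R] cosy := measurable_cosM y.
have msiny : measurable_fun [set: R] siny := measurable_sinM y.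
have cosy1 s : `|cosy s| <= 1 by exact: cos_max.
have siny1 s : `|siny s| <= 1 by exact: sin_max.
have iA := integrable_exp_mellinN x1 mcosy cosy1.
have iB := integrable_exp_mellinN x1 msiny siny1.
have summ (u : nat -> R) :
    (forall n, `|u n| <= expR (- (x * ln (n.+1%:R : R)))) -> cvgn (series u).
  move=> ule; apply: normed_cvg; apply: series_le_cvg (summable_zeta x1) => //.
  by move=> n; exact: normr_ge0.
have cp : cvgn (series p).
  by apply: summ => n; rewrite normrM ger0_norm ?expR_ge0// ler_piMr ?expR_ge0.
have cq : cvgn (series q).
  apply: summ => n; rewrite normrN normrM ger0_norm ?expR_ge0//.
  by rewrite ler_piMr ?expR_ge0.
(* Scaling leaves cos or sin of y(s - ln n) in the kernel; the subtraction formulas split it into a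
   combination of [cosy] and [siny], hence of [A] and [B]. *)
have comb (a b : R) (h : R -> R) :
    (forall s, h s = a * cosy s + b * siny s) ->
    \int[mu]_(t in `]0, +oo[) (expR (- t) * mellin_kernel x h t) =
    a * A + b * B.
  move=> hE; rewrite /A /B -Rintegral_lincomb//.
  by apply: eq_Rintegral => t _; rewrite /mellin_kernel hE; ring.
have termc n : \int[mu]_(t in `]0, +oo[)
    (expR (- (n.+1%:R * t)) * mellin_kernel x cosy t) = p n * A - q n * B.
  rewrite integral_exp_mellin_scale ?ler1n//.
  rewrite (comb (cosy (ln n.+1%:R)) (siny (ln n.+1%:R))) /p /q; first by ring.
  by move=> s; rewrite /cosy /siny mulrBl cosB; ring.
have terms n : \int[mu]_(t in `]0, +oo[)
    (expR (- (n.+1%:R * t)) * mellin_kernel x siny t) = p n * B + q n * A.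
  rewrite integral_exp_mellin_scale ?ler1n//.
  rewrite (comb (- siny (ln n.+1%:R)) (cosy (ln n.+1%:R))) /p /q; first by ring.
  by move=> s; rewrite /cosy /siny mulrBl sinB; ring.
set P := limn (series p); set Q := limn (series q).
have cP (a : R) : series p N * a @[N --> \oo] --> P * a.
  by apply: cvgM; [exact: cp|exact: cvg_cst].
have cQ (a : R) : series q N * a @[N --> \oo] --> Q * a.
  by apply: cvgM; [exact: cq|exact: cvg_cst].
exists P, Q; split => //.
- apply: (cvg_unique _ _ (cvg_sum_integral_mellin x1 mcosy cosy1)) => //.
  rewrite (_ : series _ = fun N => series p N * A - series q N * B).
    by apply: cvgB; [exact: cP|exact: cQ].
  apply/funext => N; rewrite /series/= !mulr_suml -sumrB.
  by apply: eq_bigr => n _.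
- apply: (cvg_unique _ _ (cvg_sum_integral_mellin x1 msiny siny1)) => //.
  rewrite (_ : series _ = fun N => series p N * B + series q N * A).
    by apply: cvgD; [exact: cP|exact: cQ].
  apply/funext => N; rewrite /series/= !mulr_suml -big_split/=.
  by apply: eq_bigr => n _.
Qed.

End Complex_case.

(** * Bicomplex integrals and powers in idempotent coordinates *)

Section Bicomplex_integral.
Variable R : realType.
Notation mu := (@lebesgue_measure R).
Implicit Types (f : R -> bicomplex R) (b : bool) (u : bicomplex R).

(** The four real coordinates are half-sums and half-differences of the idempotent ones. *)
Lemma bc_integrable_idem f :
  (forall b, mu.-integrable `]0, +oo[ (EFin \o (idem_re b \o f))) ->
  (forall b, mu.-integrable `]0, +oo[ (EFin \o (idem_im b \o f))) ->
  bc_integrable `]0, +oo[ f.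
Proof.
move=> fr fi.
have half (g h k : R -> R) (c : R) : mu.-integrable `]0, +oo[ (EFin \o g) ->
    mu.-integrable `]0, +oo[ (EFin \o h) ->
    (forall t, k t = 2^-1 * g t + c * h t) ->
    mu.-integrable `]0, +oo[ (fun t => (k t)%:E).
  move=> gi hi kE.
  have := @integrable_lincomb _ (measurableTypeR R) R mu _ 2^-1 c _ _
    (measurable_itv `]0, +oo[) gi hi; apply: eq_integrable => //.
  by move=> t _; rewrite /= kE.
split.
- apply: (half _ _ _ 2^-1 (fr false) (fr true)) => t.
  by rewrite /= /idem_re expr0 expr1; field.
- apply: (half _ _ _ (- 2^-1) (fr false) (fr true)) => t.
  by rewrite /= /idem_re expr0 expr1; field.
- apply: (half _ _ _ 2^-1 (fi false) (fi true)) => t.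
  by rewrite /= /idem_im expr0 expr1; field.
- apply: (half _ _ _ (- 2^-1) (fi false) (fi true)) => t.
  by rewrite /= /idem_im expr0 expr1; field.
Qed.

Lemma idem_re_bc_integral b f : bc_integrable `]0, +oo[ f ->
  idem_re b (bc_integral `]0, +oo[ f) =
  \int[mu]_(t in `]0, +oo[) idem_re b (f t).
Proof.
move=> [f11 f12 _ _]; rewrite /bc_integral /idem_re /=.
rewrite -[X in X + _]mul1r -Rintegral_lincomb//.
by apply: eq_Rintegral => t _; rewrite mul1r.
Qed.

Lemma idem_im_bc_integral b f : bc_integrable `]0, +oo[ f ->
  idem_im b (bc_integral `]0, +oo[ f) =
  \int[mu]_(t in `]0, +oo[) idem_im b (f t).
Proof.
move=> [_ _ f21 f22]; rewrite /bc_integral /idem_im /=.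
rewrite -[X in X + _]mul1r -Rintegral_lincomb//.
by apply: eq_Rintegral => t _; rewrite mul1r.
Qed.

Lemma idem_re_bc_pow b (t : R) u :
  idem_re b (bc_pow t u) = expR (idem_re b u * ln t) * cos (ln t * idem_im b u).
Proof.
rewrite /bc_pow bc_exp_idem idem_re_of_idem idem_reZ idem_imZ.
by rewrite [X in expR X]mulrC.
Qed.

Lemma idem_im_bc_pow b (t : R) u :
  idem_im b (bc_pow t u) = expR (idem_re b u * ln t) * sin (ln t * idem_im b u).
Proof.
rewrite /bc_pow bc_exp_idem idem_im_of_idem idem_reZ idem_imZ.
by rewrite [X in expR X]mulrC.
Qed.

Lemma idem_re_kernel b (w : R -> R) u t :
  idem_re b (w t *: bc_pow t (u - 1)) =
  w t * mellin_kernel (idem_re b u) (fun s => cos (s * idem_im b u)) t.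
Proof.
rewrite idem_reZ idem_re_bc_pow idem_reD idem_reN idem_re1.
by rewrite idem_imD idem_imN idem_im1 subr0.
Qed.

Lemma idem_im_kernel b (w : R -> R) u t :
  idem_im b (w t *: bc_pow t (u - 1)) =
  w t * mellin_kernel (idem_re b u) (fun s => sin (s * idem_im b u)) t.
Proof.
rewrite idem_imZ idem_im_bc_pow idem_reD idem_reN idem_re1.
by rewrite idem_imD idem_imN idem_im1 subr0.
Qed.

(** The projections pi_1 and pi_2 of [re_j u] are the real parts of the two components, and both
    projections of 1 equal 1. *)
Lemma hyp_lt_idem_re u b : hyp_lt 1 (re_j u) -> 1 < idem_re b u.
Proof.
rewrite /hyp_lt /hyp_pi1 /hyp_pi2 /re_j /= addr0 subr0 => -[lt1 lt2].
by case: b; rewrite /idem_re ?expr0 ?expr1 ?mulN1r ?mul1r.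
Qed.

End Bicomplex_integral.

(** * Assembling the two components *)

Theorem theorem5p4 (R : realType) (omega : bicomplex R)
    (homega : hyp_lt 1 (re_j omega)) :
  let F := fun t : R => (expR t - 1)^-1 *: bc_pow t (omega - 1) in
  bc_integrable `]0, +oo[ F /\
  bc_zeta omega * bc_Gamma omega = bc_integral `]0, +oo[ F.
Proof.
move=> F.
have x1 b := hyp_lt_idem_re b homega.
pose G t := expR (- t) *: bc_pow t (omega - 1).
pose C b :=
  mellin_kernel (idem_re b omega) (fun s => cos (s * idem_im b omega)).
pose S b :=
  mellin_kernel (idem_re b omega) (fun s => sin (s * idem_im b omega)).
have cosM1 (y s : R) : `|cos (s * y)| <= 1 by exact: cos_max.
have sinM1 (y s : R) : `|sin (s * y)| <= 1 by exact: sin_max.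
have reF b t : idem_re b (F t) = (expR t - 1)^-1 * C b t.
  exact: (idem_re_kernel b (fun t => (expR t - 1)^-1)).
have imF b t : idem_im b (F t) = (expR t - 1)^-1 * S b t.
  exact: (idem_im_kernel b (fun t => (expR t - 1)^-1)).
have reG b t : idem_re b (G t) = expR (- t) * C b t.
  exact: (idem_re_kernel b (fun t => expR (- t))).
have imG b t : idem_im b (G t) = expR (- t) * S b t.
  exact: (idem_im_kernel b (fun t => expR (- t))).
have intF : bc_integrable `]0, +oo[ F.
  apply: bc_integrable_idem => b.
    under [_ \o F]eq_fun do rewrite /= reF.
    exact: integrable_bose_mellin (x1 b) (measurable_cosM _) (cosM1 _).
  under [_ \o F]eq_fun do rewrite /= imF.
  exact: integrable_bose_mellin (x1 b) (measurable_sinM _) (sinM1 _).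
have intG : bc_integrable `]0, +oo[ G.
  apply: bc_integrable_idem => b.
    under [_ \o G]eq_fun do rewrite /= reG.
    exact: integrable_exp_mellinN (x1 b) (measurable_cosM _) (cosM1 _).
  under [_ \o G]eq_fun do rewrite /= imG.
  exact: integrable_exp_mellinN (x1 b) (measurable_sinM _) (sinM1 _).
split=> //.
(* The complex identity is applied in both components; choice gathers its limits into functions of
   [b], the shape that [of_idem] takes. *)
have /choice[P /choice[Q PQ]] b :=
  zeta_gamma_coordinates (idem_im b omega) (x1 b).
have zetaE : bc_zeta omega = of_idem P Q.
  apply: lim_of_idem => b; have [cP cQ _ _] := PQ b.
    rewrite idem_re_series.
    suff -> : idem_re b \o (fun n : nat => bc_pow n.+1%:R (- omega)) =
      fun n => expR (- (idem_re b omega * ln (n.+1%:R : R))) *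
        cos (ln n.+1%:R * idem_im b omega) by exact: cP.
    apply/funext => n; rewrite /= idem_re_bc_pow idem_reN idem_imN.
    by rewrite mulrN cosN mulNr.
  rewrite idem_im_series.
  suff -> : idem_im b \o (fun n : nat => bc_pow n.+1%:R (- omega)) =
    fun n => - (expR (- (idem_re b omega * ln (n.+1%:R : R))) *
      sin (ln n.+1%:R * idem_im b omega)) by exact: cQ.
  apply/funext => n; rewrite /= idem_im_bc_pow idem_reN idem_imN.
  by rewrite mulrN sinN mulNr mulrN.
have reIF b : idem_re b (bc_integral `]0, +oo[ F) =
    \int[@lebesgue_measure R]_(t in `]0, +oo[) ((expR t - 1)^-1 * C b t).
  rewrite (idem_re_bc_integral b intF).
  by apply: eq_Rintegral => t _; exact: reF.
have imIF b : idem_im b (bc_integral `]0, +oo[ F) =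
    \int[@lebesgue_measure R]_(t in `]0, +oo[) ((expR t - 1)^-1 * S b t).
  rewrite (idem_im_bc_integral b intF).
  by apply: eq_Rintegral => t _; exact: imF.
have reIG b : idem_re b (bc_integral `]0, +oo[ G) =
    \int[@lebesgue_measure R]_(t in `]0, +oo[) (expR (- t) * C b t).
  rewrite (idem_re_bc_integral b intG).
  by apply: eq_Rintegral => t _; exact: reG.
have imIG b : idem_im b (bc_integral `]0, +oo[ G) =
    \int[@lebesgue_measure R]_(t in `]0, +oo[) (expR (- t) * S b t).
  rewrite (idem_im_bc_integral b intG).
  by apply: eq_Rintegral => t _; exact: imG.
rewrite zetaE -[bc_Gamma omega]/(bc_integral `]0, +oo[ G).
(* Abstracting the integrals keeps unification from unfolding them. *)
move: (bc_integral _ G) (bc_integral _ F) reIF imIF reIG imIG.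
move=> IG IF reIF imIF reIG imIG.
(* In each component the bicomplex product is complex multiplication, so [reE] and [imE] are the two
   equations to prove. *)
apply: idem_inj => b; have [_ _ reE imE] := PQ b.
  by rewrite idem_reM idem_re_of_idem idem_im_of_idem reIF reIG imIG.
by rewrite idem_imM idem_re_of_idem idem_im_of_idem imIF reIG imIG.
Qed.
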